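(* Let $X\subset\mathbb{R}^s$ be open, let $f:X\to\mathbb{R}$ and $g_1,\dots,g_m:X\to\mathbb{R}$, and consider the scalar problem (P) of minimizing $f(x)$ subject to $g_i(x)\le 0$, $i=1,\dots,m$. Let $\bar x$ be a local minimizer of (P) and let $d\in\mathbb{R}^s$ be a nonzero critical direction at $\bar x$. Suppose that: (i) the functions $g_i$, $i\notin I(\bar x)$, are continuous at $\bar x$; (ii) the functions $f$ and $g_i$, $i\in I(\bar x)$, are continuously differentiable; (iii) if $\nabla f(\bar x)d=0$, then $f''(\bar x,d)$ exists, and if $\nabla g_i(\bar x)d=0$, $i\in I(\bar x)$, then $g_i''(\bar x,d)$ exists. Suppose that the constraint qualification $\mathrm{cl}(A(\bar x,d))=B(\bar x,d)$ and the Guignard constraint qualification $L(\bar x)=PT(S,\bar x)$ hold. Then there exist a multiplier $\lambda_1>0$ and nonnegative Lagrange multipliers $\mu_1,\dots,\mu_m$ which satisfy the second-order KKT conditions $$\mu_i g_i(\bar x)=0,\ i=1,\dots,m,\qquad \nabla\mathcal{L}(\bar x)=0,$$ $$\mathcal{L}''(\bar x,d)=\lambda_1 f''(\bar x,d)+\sum_{i\in I(\bar x)}\mu_i g_i''(\bar x,d)\ge 0,$$ where $\mathcal{L}=\lambda_1f+\sum_{i=1}^m\mu_ig_i$ is the Lagrange function.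
   Context: The feasible set is $S=\{x\in X\mid g_i(x)\le 0,\ i=1,\dots,m\}$, and for $x\in S$ the set of active constraints is $I(x)=\{i\in\{1,\dots,m\}\mid g_i(x)=0\}$. A local minimizer of (P) is a point $\bar x\in S$ such that $f(x)\ge f(\bar x)$ for all $x\in U\cap S$, for some neighbourhood $U$ of $\bar x$. A direction $d\in\mathbb{R}^s$ is critical at $x\in S$ if $\nabla f(x)d\le 0$ and $\nabla g_i(x)d\le 0$ for all $i\in I(x)$. $K(\bar x,d)=\{i\in I(\bar x)\mid \nabla g_i(\bar x)d=0\}$. For $h:X\to\mathbb{R}$ Fréchet differentiable at $x$, the second-order directional derivative in direction $u\in\mathbb{R}^s$ is, when it exists as an element of $\mathbb{R}$, the limit $h''(x,u)=\lim_{t\to+0}2t^{-2}[h(x+tu)-h(x)-t\nabla h(x)u]$. For feasible $x$ and a direction $d$, $$A(x,d)=\{z\in\mathbb{R}^s\mid \forall i\in K(x,d)\ \exists\delta_i>0:\ g_i(x+td+\tfrac12t^2z)\le 0\ \ \forall t\in(0,\delta_i)\},$$ $$B(x,d)=\{z\in\mathbb{R}^s\mid \nabla g_i(x)z+g_i''(x,d)\le 0\ \text{for each } i\in K(x,d)\},$$ with $A(x,d)=B(x,d)=\mathbb{R}^s$ if $K(x,d)=\emptyset$. $\mathrm{cl}$ denotes closure. The linearizing cone is $L(\bar x)=\{u\in\mathbb{R}^s\mid \nabla g_i(\bar x)u\le 0,\ i\in I(\bar x)\}$. The Bouligand tangent cone $T(S,\bar x)$ is the set of $u\in\mathbb{R}^s$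 for which there exist $t_k>0$, $t_k\to 0$, and $u_k\to u$ in $\mathbb{R}^s$ with $\bar x+t_ku_k\in S$ for all positive integers $k$. The pseudotangent cone is $PT(S,\bar x)=\mathrm{cl}(\mathrm{conv}\,T(S,\bar x))$, the closed convex hull of $T(S,\bar x)$. *)

(* Defs.v *)
From HB Require Import structures.
From mathcomp Require Import all_boot all_order all_algebra.
From mathcomp Require Import all_classical all_reals all_analysis.

Set Implicit Arguments.
Unset Strict Implicit.
Unset Printing Implicit Defensive.

Import Order.TTheory GRing.Theory Num.Theory.
Import numFieldNormedType.Exports.

Local Open Scope classical_set_scope.
Local Open Scope ring_scope.

(* A function h : X -> R on an open set X is represented by a total function on
   R^s whose values outside X are unspecified. Since X is open, limits,
   derivatives and continuity at points of X do not depend on these values;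
   wherever membership in X is not automatic it is required explicitly.
   The product (nabla h(x)) u is the library differential 'd h x u. *)

Section calculus.
Context {R : realType} {s : nat}.
Implicit Types (h : 'rV[R]_s -> R) (X : set 'rV[R]_s) (x u : 'rV[R]_s).

Definition grad h x : 'rV[R]_s := \row_j 'd h x (delta_mx 0 j).

Definition C1_on X h : Prop :=
  forall x, X x -> differentiable h x /\ {for x, continuous (grad h)}.

Definition dd2_quot h x u (t : R) : R :=
  2 / t ^+ 2 * (h (x + t *: u) - h x - t * 'd h x u).

(* h''(x,u) is the limit of [dd2_quot h x u] at 0+; only meaningful for h differentiable at x. *)
Definition ex_dd2 h x u : Prop := cvg (dd2_quot h x u t @[t --> 0^'+]).

(* Unspecified when [ex_dd2 h x u] fails. *)
Definition dd2 h x u : R := lim (dd2_quot h x u t @[t --> 0^'+]).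

End calculus.

Section tangent_cones.
Context {R : realType} {s : nat}.
Implicit Types (S : set 'rV[R]_s) (x : 'rV[R]_s).

Definition bouligand_cone S x : set 'rV[R]_s :=
  [set u | exists (t_ : nat -> R) (u_ : nat -> 'rV[R]_s),
    [/\ forall k, 0 < t_ k, t_ @ \oo --> (0 : R), u_ @ \oo --> u
      & forall k, S (x + t_ k *: u_ k)]].

Definition convex_hull (A : set 'rV[R]_s) : set 'rV[R]_s :=
  smallest (fun C : set 'rV[R]_s => convex_set C) A.

Definition pseudotangent_cone S x : set 'rV[R]_s :=
  closure (convex_hull (bouligand_cone S x)).

End tangent_cones.

Section problem.
Context {R : realType} {s m : nat}.
Variables (X : set 'rV[R]_s) (f : 'rV[R]_s -> R) (g : 'I_m -> 'rV[R]_s -> R).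
Implicit Types x d : 'rV[R]_s.

Definition feasible : set 'rV[R]_s := [set x | X x /\ forall i, g i x <= 0].

Definition local_minimizer x : Prop :=
  feasible x /\ \forall y \near x, feasible y -> f x <= f y.

Definition active x : pred 'I_m := [pred i | g i x == 0].

Definition critical_direction x d : Prop :=
  'd f x d <= 0 /\ forall i, i \in active x -> 'd (g i) x d <= 0.

Definition active_crit x d : pred 'I_m :=
  [pred i | (i \in active x) && ('d (g i) x d == 0)].

(* [active_crit], [setA2] and [setB2] are K(x,d), A(x,d) and B(x,d); the latter
   two are the whole space when K(x,d) is empty. *)
Definition setA2 x d : set 'rV[R]_s :=
  [set z | forall i, i \in active_crit x d ->
    exists2 delta : R, 0 < delta & forall t : R, 0 < t < delta ->
      let y := x + t *: d + (2^-1 * t ^+ 2) *: z in X y /\ g i y <= 0].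

Definition setB2 x d : set 'rV[R]_s :=
  [set z | forall i, i \in active_crit x d ->
    'd (g i) x z + dd2 (g i) x d <= 0].

Definition linearizing_cone x : set 'rV[R]_s :=
  [set u | forall i, i \in active x -> 'd (g i) x u <= 0].

Definition lagrangian (lambda1 : R) (mu : 'I_m -> R) x : R :=
  lambda1 * f x + \sum_(i < m) mu i * g i x.

End problem.

(* Main.v *)
(* Guignard's condition extends the first-order inequality [0 <= 'd f xbar u]
   from the tangent cone to its closed convex hull, the linearizing cone; in
   particular ['d f xbar d = 0]. A parabolic arc [xbar + t d + t^2 z / 2] with
   [z] in A(xbar,d) is feasible for small [t], so that
   [0 <= 'd f xbar z + f''(xbar,d)] on A(xbar,d), hence on its closure
   B(xbar,d). Homogenize the inequalities defining B with a variable
   [tau >= 0], looking for [0 <= 'd f xbar z + tau f''(xbar,d)]: the case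
   [tau > 0] rescales to a point of B, and in the case [tau = 0] the point
   [z + c d] lies in the linearizing cone for [c] large. Farkas' lemma in
   dimension [s + 1] then yields multipliers with [lambda1 = 1]; no separate
   argument is needed when B is empty. *)
Require Import Defs.
From HB Require Import structures.
From mathcomp Require Import all_boot all_order all_algebra.
From mathcomp Require Import all_classical all_reals all_analysis.
From mathcomp Require Import ring lra.

Import Order.TTheory GRing.Theory Num.Theory.
Import numFieldNormedType.Exports.

Local Open Scope classical_set_scope.
Local Open Scope ring_scope.

(** * Farkas' lemma for finitely many linear functionals *)

(** Algebraic induction on the number of functionals: either the implication survives without the
    first one, which then gets multiplier 0, or a point [x0] shows it to be essential and the
    problem descends to its kernel. *)
Lemma farkas (R : realFieldType) (V : lmodType R) (n : nat)
    (a : 'I_n -> V -> R) (c : V -> R) :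
  (forall i, scalar (a i)) -> scalar c ->
  (forall x, (forall i, a i x <= 0) -> c x <= 0) ->
  exists lam : 'I_n -> R,
    (forall i, 0 <= lam i) /\ forall x, c x = \sum_(i < n) lam i * a i x.
Proof.
have scalarN (h : V -> R) x : scalar h -> h (- x) = - h x.
  move=> hl; have h0 : h 0 = 0 by move: (hl (-1) 0 0); rewrite scaler0 addr0; lra.
  by move: (hl (-1) x 0); rewrite addr0 h0 scaleN1r mulN1r addr0.
elim: n => [|n IHn] in a c * => a_lin c_lin ac.
  exists (fun=> 0); split=> // x; rewrite big_ord0.
  have cx := ac x (fun i => False_ind _ (notF (ltn_ord i))).
  have := ac (- x) (fun i => False_ind _ (notF (ltn_ord i))).
  by rewrite scalarN //; lra.
have [[x0 [ax0 cx0]]|nx0] := pselect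
    (exists x0, (forall i, a (lift ord0 i) x0 <= 0) /\ 0 < c x0); last first.
  have [|x ax|lam [lam0 clam]] := IHn (fun i => a (lift ord0 i)) c _ c_lin.
  - by move=> i; exact: a_lin.
  - by rewrite leNgt; apply/negP => cx; apply: nx0; exists x.
  exists (fun i => if unlift ord0 i is Some j then lam j else 0); split.
    by move=> i; case: unliftP.
  move=> x; rewrite big_ord_recl unlift_none mul0r add0r clam.
  by apply: eq_bigr => i _; rewrite liftK.
(* All other constraints hold at [x0] and [0 < c x0], so the first one must fail there. *)
have b0 : 0 < a ord0 x0.
  rewrite ltNge; apply/negP => b0; have : c x0 <= 0.
    by apply: ac => i; case: (unliftP ord0 i) => [j ->|->].
  by rewrite leNgt cx0.
(* Project along [x0] onto the kernel of [a ord0]. *)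
pose proj (h : V -> R) x := h x - a ord0 x / a ord0 x0 * h x0.
have projE (h : V -> R) x : scalar h ->
    proj h x = h (- (a ord0 x / a ord0 x0) *: x0 + x).
  by move=> h_lin; rewrite h_lin /proj; ring.
have proj_lin (h : V -> R) : scalar h -> scalar (proj h).
  move=> h_lin k x y; rewrite /proj h_lin a_lin; field; exact: lt0r_neq0.
have [||x ax|lam [lam0 clam]] := IHn (fun i => proj (a (lift ord0 i))) (proj c).
- by move=> i; apply: proj_lin.
- exact: proj_lin.
- rewrite projE //; apply: ac => i; case: (unliftP ord0 i) => [j ->|->].
    by rewrite -projE.
  by rewrite a_lin mulNr divfK ?lt0r_neq0 // addNr.
(* This value is forced by evaluating the identity at [x0]; it is nonnegative since [c x0] is
   positive and the other functionals are nonpositive there. *)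
pose mu := (c x0 - \sum_(i < n) lam i * a (lift ord0 i) x0) / a ord0 x0.
exists (fun i => if unlift ord0 i is Some j then lam j else mu); split.
  move=> i; case: unliftP => // _; apply: divr_ge0; last exact: ltW.
  rewrite subr_ge0; apply: le_trans (ltW cx0); apply: sumr_le0 => j _.
  by rewrite mulr_ge0_le0.
move=> x; rewrite big_ord_recl unlift_none.
under [in RHS]eq_bigr => i _ do rewrite liftK.
have -> : c x = proj c x + a ord0 x / a ord0 x0 * c x0 by rewrite /proj subrK.
rewrite clam /mu /=.
under eq_bigr => i _ do rewrite /proj /= mulrBr mulrCA.
rewrite big_split /= sumrN -mulr_sumr.
by ring.
Qed.

(** * Directional limits, increments of C1 functions, parabolic arcs *)

Section calculus.
#[local] Set Implicit Arguments.
#[local] Unset Strict Implicit.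
Context {R : realType}.

(* Frechet differentiability gives directional derivatives in the sense of
   Hadamard: the direction may vary with the step. *)
Lemma differentiable_hadamard {V : normedModType R} {T : Type}
    {F : set_system T} {FF : Filter F} (h : V -> R) (x u : V) (t : T -> R) (v : T -> V) :
  differentiable h x -> (\forall k \near F, 0 < t k) ->
  t k @[k --> F] --> 0 -> v k @[k --> F] --> u ->
  (h (x + t k *: v k) - h x) / t k @[k --> F] --> 'd h x u.
Proof.
move=> dh t_gt0 t0 vu.
have tv0 : t k *: v k @[k --> F] --> (0 : V).
  by rewrite -(scale0r u); exact: cvgZ.
rewrite -[X in _ --> X]addr0.
have dhv : 'd h x (v k) @[k --> F] --> 'd h x u.
  by apply: cvg_comp vu _; exact: diff_continuous.
have /eqaddoP ho := diff_locally dh.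
have ot0 : (h (x + t k *: v k) - h x - 'd h x (t k *: v k)) / t k @[k --> F] --> 0.
  (* [C] eventually bounds [|v k|], so a remainder bound with constant [e / C] yields at most
     [e * t k]. *)
  apply/cvgr0Pnorm_le => e e0; pose C := `|u| + 1.
  have C0 : 0 < C by rewrite ltr_wpDl.
  near=> k; have tk : 0 < t k by near: k.
  rewrite normrM normfV (gtr0_norm tk) ler_pdivrMr //.
  have vC : `|v k| <= C.
    by near: k; apply: cvgr_norm_le vu _ _; rewrite ltrDl.
  apply: (@le_trans _ _ (e / C * `|t k *: v k|)); last first.
    rewrite normrZ (gtr0_norm tk).
    have -> : e / C * (t k * `|v k|) = e * t k * (`|v k| / C) by ring.
    by rewrite ler_piMr ?ler_pdivrMr ?mul1r // mulr_ge0 // ltW.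
  rewrite -addrA -opprD [x + _]addrC; near: k.
  exact: tv0 _ (ho _ (divr_gt0 e0 C0)).
apply: cvg_trans (cvgD dhv ot0); apply: near_eq_cvg; near=> k.
have tk : 0 < t k by near: k.
have dE : 'd h x (t k *: v k) = t k * 'd h x (v k) by exact: linearZ.
by rewrite fctE /= dE; field; rewrite gt_eqF.
Unshelve. all: by end_near. Qed.

Lemma cvg_sum (T I : Type) (F : set_system T) {FF : Filter F} (r : seq I)
    (P : pred I) (u : I -> T -> R) (l : I -> R) :
  (forall i, P i -> u i k @[k --> F] --> l i) ->
  \sum_(i <- r | P i) u i k @[k --> F] --> \sum_(i <- r | P i) l i.
Proof. by move=> ul; exact: (@cvg_big R I +%R 0 P add_continuous T F r u l FF ul). Qed.

Lemma cvg_right0 : t @[t --> (0 : R)^'+] --> (0 : R).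
Proof. exact: cvg_within. Qed.

Lemma cvg_scale_right0 (V : normedModType R) (u v : V) (a : R) :
  u + (a * t) *: v @[t --> (0 : R)^'+] --> u.
Proof.
suff : u + (a * t) *: v @[t --> (0 : R)^'+] --> u + (a * 0) *: v.
  by rewrite mulr0 scale0r addr0.
apply: cvgD; first exact: cvg_cst.
by apply: cvgZr_tmp; apply: cvgM; [exact: cvg_cst|exact: cvg_right0].
Qed.

Section row_vectors.
Context {s : nat}.
Implicit Types (X : set 'rV[R]_s) (h : 'rV[R]_s -> R) (x y z d : 'rV[R]_s).

Lemma diff_scale h x (k : R) y : 'd h x (k *: y) = k * 'd h x y.
Proof. exact: linearZ. Qed.

Lemma closed_diff_ge h x (r : R) : differentiable h x ->
  closed [set v | r <= 'd h x v].
Proof.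
move=> dh; apply: (@preimage_closed _ _ ('d h x) [set r' : R | r <= r']).
  by move=> v _; exact: diff_continuous.
exact: closed_ge.
Qed.

(** By minimality the difference quotients along a tangent sequence are eventually nonnegative, and
    they converge to ['d h x u]. *)
Lemma local_min_tangent (S : set 'rV[R]_s) h x u :
  differentiable h x -> (\forall y \near x, S y -> h x <= h y) ->
  bouligand_cone S x u -> 0 <= 'd h x u.
Proof.
move=> dh xmin [t [v [t0 tcv vcv Sv]]].
have dcv : (h (x + t k *: v k) - h x) / t k @[k --> \oo] --> 'd h x u.
  by apply: differentiable_hadamard => //; exact: nearW.
rewrite -(cvg_lim _ dcv) //; apply: limr_ge; first by apply: cvgP dcv.
have tv0 : x + t k *: v k @[k --> \oo] --> x.
  by rewrite -[X in _ --> X]addr0 -(scale0r u); apply: cvgD (cvg_cst _) (cvgZ _ _).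
near=> k; apply: divr_ge0; last exact: ltW.
rewrite subr_ge0; have := Sv k.
near: k; exact: tv0 _ xmin.
Unshelve. all: by end_near. Qed.

Lemma diff_grad h x z : 'd h x z = \sum_j z 0 j * grad h x 0 j.
Proof.
rewrite [X in 'd h x X]row_sum_delta linear_sum /=.
by apply: eq_bigr => j _; rewrite linearZ /= mxE.
Qed.

Lemma C1_diff_continuous X h x z : C1_on X h -> X x ->
  'd h y z @[y --> x] --> 'd h x z.
Proof.
move=> hC1 Xx; have [_ gh] := hC1 x Xx.
pose dot (M : 'rV[R]_s) := \sum_j z 0 j * M 0 j.
have dot_cont : continuous dot.
  move=> M.
  apply: (@cvg_sum _ _ (nbhs M) _ _ _ (fun j (N : 'rV[R]_s) => z 0 j * N 0 j)).
  move=> j _.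
  by apply: cvgM; [exact: cvg_cst|exact: coord_continuous].
have -> : (fun y => 'd h y z) = dot \o grad h by apply/funext => y; exact: diff_grad.
rewrite diff_grad; exact: (cvg_comp _ _ gh (dot_cont _)).
Qed.

(** Mean value theorem on the segment from [y] to [y + r z]. The base point must be free to move:
    the increment of order [t^2] starting at [x + t d] is needed, and differentiability at [x] alone
    would leave an error [o(t)]. *)
Lemma C1_increment_le X h x z (e : R) : open X -> C1_on X h -> X x -> 0 < e ->
  exists2 delta : R, 0 < delta & forall y (r : R), 0 <= r ->
    `|y - x| + r * `|z| < delta -> h (y + r *: z) - h y <= r * ('d h x z + e).
Proof.
move=> oX hC1 Xx e0.
have : \forall y \near x, X y /\ 'd h y z <= 'd h x z + e.
  near=> y; split; near: y; first exact: open_nbhs_nbhs.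
  by apply: cvgr_le (C1_diff_continuous hC1 Xx) _ _; rewrite ltrDl.
move=> /nbhs_normP[delta /= delta0 Hd]; exists delta => // y r r0 yr.
have Hc c : 0 <= c <= r -> X (y + c *: z) /\ 'd h (y + c *: z) z <= 'd h x z + e.
  move=> /andP[c0 cr]; apply: Hd; rewrite /= distrC addrAC.
  apply: le_lt_trans yr; apply: le_trans (ler_normD _ _) _.
  by rewrite lerD2l normrZ ger0_norm // ler_wpM2r.
have Dc c : 0 <= c <= r ->
    is_derive c 1 (fun c => h (y + c *: z)) ('d h (y + c *: z) z).
  move=> /Hc[Xc _]; have [dh _] := hC1 _ Xc.
  pose p c : 'rV[R]_s := y + c *: z.
  have dp : is_diff c p ( *:%R^~ z).
    have -> : p = cst y + ( *:%R^~ z : R -> _) by [].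
    by have := is_diffD (is_diff_cst y c) (is_diff_scalel c z); rewrite add0r.
  have dhp : is_diff c (h \o p) ('d h (p c) \o *:%R^~ z).
    by apply: is_diff_comp; exact: differentiableP.
  split; first exact: diff_derivable.
  by rewrite deriveE // diff_val /= scale1r.
have [||c cr] := @MVT_segment R (fun c => h (y + c *: z))
    (fun c => 'd h (y + c *: z) z) 0 r r0.
- by move=> c; rewrite in_itv /= => /andP[? ?]; apply: Dc; rewrite !ltW.
- apply: derivable_within_continuous => c; rewrite in_itv /= => /Dc cD.
  exact: ex_derive.
rewrite scale0r addr0 subr0 mulrC => ->; rewrite ler_wpM2l //.
by have [] := Hc c _.
Unshelve. all: by end_near. Qed.

(** Exhibits the arc as a step [t] in a direction tending to [d], as [differentiable_hadamard]
    expects. *)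
Lemma parabolaE x d z (t : R) :
  x + t *: d + (2^-1 * t ^+ 2) *: z = x + t *: (d + (2^-1 * t) *: z).
Proof. by rewrite scalerDr addrA scalerA expr2 mulrCA. Qed.

Lemma cvg_parabola x d z :
  x + t *: d + (2^-1 * t ^+ 2) *: z @[t --> (0 : R)^'+] --> x.
Proof.
rewrite (eq_cvg _ _ (parabolaE x d z)).
suff : x + t *: (d + (2^-1 * t) *: z) @[t --> (0 : R)^'+] --> x + 0 *: d.
  by rewrite scale0r addr0.
apply: cvgD; first exact: cvg_cst.
by apply: cvgZ; [exact: cvg_right0|exact: cvg_scale_right0].
Qed.

End row_vectors.

End calculus.

(** * Necessary inequalities at a local minimizer *)

Section problem.
#[local] Set Implicit Arguments.
#[local] Unset Strict Implicit.
Context {R : realType} {s m : nat}.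
Variables (X : set 'rV[R]_s) (f : 'rV[R]_s -> R) (g : 'I_m -> 'rV[R]_s -> R).
Implicit Types (x d u z : 'rV[R]_s).

(** The half-space [0 <= 'd f x v] is closed, convex and contains the tangent cone. *)
Lemma pseudotangent_cone_diff_ge0 x u : differentiable f x ->
  local_minimizer X f g x -> pseudotangent_cone (feasible X g) x u ->
  0 <= 'd f x u.
Proof.
move=> df [_ xmin]; pose H : set 'rV[R]_s := [set v | 0 <= 'd f x v].
have Hclosed : closed H by exact: closed_diff_ge.
have HT : bouligand_cone (feasible X g) x `<=` H.
  by move=> v; exact: (local_min_tangent df xmin).
have Hconv : convex_set (H : set (convex_lmodType _)).
  move=> v w p; rewrite !inE /H /= => v0 w0.
  by rewrite linearD !diff_scale addr_ge0 // mulr_ge0 // subr_ge0.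
suff : closure (convex_hull (bouligand_cone (feasible X g) x)) `<=` H by apply.
have -> : H = closure H by exact: (closure_id _).1.
by apply: closureS; exact: smallest_sub.
Qed.

(** Inactive constraints stay negative by continuity, active ones with negative derivative along [d]
    decrease at first order, and those in K(x,d) are covered by membership in A(x,d). *)
Lemma feasible_parabola x d z : open X -> feasible X g x ->
  (forall i, i \in active g x -> 'd (g i) x d <= 0) ->
  (forall i, i \notin active g x -> {for x, continuous (g i)}) ->
  (forall i, i \in active g x -> differentiable (g i) x) ->
  setA2 X g x d z ->
  \forall t \near (0 : R)^'+, feasible X g (x + t *: d + (2^-1 * t ^+ 2) *: z).
Proof.
move=> oX [Xx gx] gd gc dg Az.
suff : \forall t \near (0 : R)^'+, forall i,
    g i (x + t *: d + (2^-1 * t ^+ 2) *: z) <= 0.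
  move=> gt; near=> t; split; last by near: t.
  near: t; exact: (@cvg_parabola R s x d z) (open_nbhs_nbhs _).
apply: filter_forall => i.
have [gi|gi] := boolP (i \in active g x); last first.
  have gicv := continuous_cvg _ (gc _ gi) (@cvg_parabola R s x d z).
  apply: (cvgr_le _ (gicv _)); rewrite lt_neqAle gx andbT; exact: gi.
have gi0 : g i x = 0 by exact/eqP.
have [dgi|dgi] := eqVneq ('d (g i) x d) 0.
  have [|delta delta0 Hd] := Az i; first by rewrite inE gi dgi eqxx.
  near=> t; apply: (Hd t _).2; apply/andP; split; near: t.
    exact: nbhs_right_gt.
  exact: nbhs_right_lt.
have H := @differentiable_hadamard R _ _ (0 : R)^'+ _ (g i) x d id
  (fun t => d + (2^-1 * t) *: z) (dg i gi).
near=> t.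
have t0 : 0 < t by near: t; exact: nbhs_right_gt.
have : (g i (x + t *: (d + (2^-1 * t) *: z)) - g i x) / t < 0.
  near: t; apply: cvgr_lt; first apply: H.
  - exact: nbhs_right_gt.
  - exact: cvg_right0.
  - exact: cvg_scale_right0.
  - by rewrite lt_neqAle dgi gd.
rewrite gi0 subr0 pmulr_llt0 ?invr_gt0 // => /ltW.
by rewrite parabolaE.
Unshelve. all: by end_near. Qed.

(** The comparison of [x] with the arc passes through [x + t d]. Up to there [f] changes by
    [t^2 / 2] times the quotient, as ['d f x d = 0]; from there to the arc, by at most
    [t^2 / 2 * ('d f x z + e)]. *)
Lemma setA2_second_order x d z : open X -> C1_on X f -> X x ->
  (\forall y \near x, feasible X g y -> f x <= f y) ->
  'd f x d = 0 -> ex_dd2 f x d ->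
  (\forall t \near (0 : R)^'+, feasible X g (x + t *: d + (2^-1 * t ^+ 2) *: z)) ->
  0 <= 'd f x z + dd2 f x d.
Proof.
move=> oX fC1 Xx xmin fd0 fdd2 xt.
apply/ler_addgt0Pr => e e0; rewrite addrAC addrC -lerBlDr sub0r.
have [delta delta0 finc] := C1_increment_le z oX fC1 Xx e0.
apply: limr_ge => //; near=> t.
have t0 : 0 < t by near: t; exact: nbhs_right_gt.
have t20 : 0 < t ^+ 2 by exact: exprn_gt0.
have fmin : f x <= f (x + t *: d + (2^-1 * t ^+ 2) *: z).
  have : feasible X g (x + t *: d + (2^-1 * t ^+ 2) *: z) by near: t.
  by near: t; exact: (@cvg_parabola R s x d z) xmin.
have r0 : 0 <= 2^-1 * t ^+ 2 by apply: mulr_ge0 => //; exact: ltW.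
(* For [t < 1] the quadratic term is at most [t * |z|]; the summand 1 in the constant below keeps
   the divisor positive. *)
have small : `|x + t *: d - x| + 2^-1 * t ^+ 2 * `|z| < delta.
  rewrite [x + _]addrC addrK normrZ gtr0_norm //.
  have t1 : t < 1 by near: t; exact: nbhs_right_lt.
  have tC : t * (`|d| + `|z| + 1) < delta.
    have C0 : 0 < `|d| + `|z| + 1 by apply: ltr_wpDl => //; exact: addr_ge0.
    rewrite -ltr_pdivlMr //; near: t; apply: nbhs_right_lt; exact: divr_gt0.
  apply: le_lt_trans tC.
  have tz : t * (t * `|z|) <= t * `|z|.
    by rewrite ler_pM2l // ler_piMl // ltW.
  have tz0 : 0 <= t * `|z| by apply: mulr_ge0 => //; exact: ltW.
  rewrite !mulrDr expr2 -!mulrA; lra.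
have := finc _ _ r0 small.
have -> : dd2_quot f x d t = 2 * (f (x + t *: d) - f x) / t ^+ 2.
  by rewrite /dd2_quot fd0; ring.
rewrite ler_pdivlMr //; lra.
Unshelve. all: by end_near. Qed.

End problem.

(** * First and second derivatives of the Lagrange function *)

Section lagrangian.
#[local] Set Implicit Arguments.
#[local] Unset Strict Implicit.
Context {R : realType} {s m : nat}.
Variables (f : 'rV[R]_s -> R) (g : 'I_m -> 'rV[R]_s -> R).
Variables (lam : R) (mu : 'I_m -> R) (x : 'rV[R]_s).
Hypothesis df : differentiable f x.
Hypothesis dg : forall i, mu i != 0 -> differentiable (g i) x.

(** Inactive constraints may fail to be differentiable. Where [mu i = 0] the summand is the zero
    function, and the factor 0 cancels whatever value ['d (g i) x] takes; the second derivatives are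
    treated alike. *)
Lemma is_diff_lagrangian : is_diff x (lagrangian f g lam mu)
  (fun u => lam * 'd f x u + \sum_(i < m) mu i * 'd (g i) x u).
Proof.
have -> : lagrangian f g lam mu = lam *: f + \sum_(i < m) (mu i *: g i).
  by apply/funext => y; rewrite /lagrangian fctE fct_sumE.
have -> : (fun u => lam * 'd f x u + \sum_(i < m) mu i * 'd (g i) x u) =
    lam *: ('d f x : _ -> R) + \sum_(i < m) (mu i *: ('d (g i) x : _ -> R)).
  by apply/funext => y; rewrite fctE fct_sumE.
apply: is_diffD; first by apply: is_diffZ; exact: differentiableP.
elim/big_rec2 : _ => [|i dh h _ hE]; first exact: is_diff_cst.
apply: is_diffD => //.
have [->|mui] := eqVneq (mu i) 0; first by rewrite !scale0r; exact: is_diff_cst.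
by apply: is_diffZ; apply: differentiableP; exact: dg.
Qed.

Lemma diff_lagrangian u : 'd (lagrangian f g lam mu) x u =
  lam * 'd f x u + \sum_(i < m) mu i * 'd (g i) x u.
Proof. by have Ldiff := is_diff_lagrangian; rewrite diff_val. Qed.

Lemma dd2_quot_lagrangian d t : dd2_quot (lagrangian f g lam mu) x d t =
  lam * dd2_quot f x d t + \sum_(i < m) mu i * dd2_quot (g i) x d t.
Proof.
rewrite /dd2_quot diff_lagrangian /lagrangian.
set k := 2 / t ^+ 2.
have gE i : mu i * (k * (g i (x + t *: d) - g i x - t * 'd (g i) x d)) =
    k * (mu i * g i (x + t *: d)) - k * (mu i * g i x)
    - k * t * (mu i * 'd (g i) x d) by ring.
by rewrite (eq_bigr _ (fun i _ => gE i)) 2!sumrB -!mulr_sumr; ring.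
Qed.

Lemma cvg_dd2_lagrangian d : ex_dd2 f x d ->
  (forall i, mu i != 0 -> ex_dd2 (g i) x d) ->
  dd2_quot (lagrangian f g lam mu) x d t @[t --> 0^'+] -->
    lam * dd2 f x d + \sum_(i < m) mu i * dd2 (g i) x d.
Proof.
move=> fdd2 gdd2; rewrite (eq_cvg _ _ (dd2_quot_lagrangian d)).
apply: cvgD; first by apply: cvgM; [exact: cvg_cst|exact: fdd2].
apply: (@cvg_sum _ _ _ _ _ _ _ (fun i t => mu i * dd2_quot (g i) x d t)) => i _.
have [->|mui] := eqVneq (mu i) 0.
  by rewrite mul0r; under eq_cvg do rewrite mul0r; exact: cvg_cst.
by apply: cvgM; [exact: cvg_cst|exact: gdd2].
Qed.

End lagrangian.

(** * Multipliers from the homogenized system *)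

Theorem corollary1 (R : realType) (s m : nat) (X : set 'rV[R]_s)
    (f : 'rV[R]_s -> R) (g : 'I_m -> 'rV[R]_s -> R) (xbar d : 'rV[R]_s)
    (X_open : open X)
    (xbar_min : local_minimizer X f g xbar)
    (d_neq0 : d != 0)
    (d_crit : critical_direction f g xbar d)
    (g_cont : forall i, i \notin active g xbar ->
       {for xbar, continuous (g i)})
    (f_C1 : C1_on X f)
    (g_C1 : forall i, i \in active g xbar -> C1_on X (g i))
    (f_dd2 : 'd f xbar d = 0 -> ex_dd2 f xbar d)
    (g_dd2 : forall i, i \in active g xbar -> 'd (g i) xbar d = 0 ->
       ex_dd2 (g i) xbar d)
    (CQ2 : closure (setA2 X g xbar d) = setB2 g xbar d)
    (Guignard :
       linearizing_cone g xbar = pseudotangent_cone (feasible X g) xbar) :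
  exists (lambda1 : R) (mu : 'I_m -> R),
    let L := lagrangian f g lambda1 mu in
    [/\ 0 < lambda1,
        forall i, 0 <= mu i,
        forall i, mu i * g i xbar = 0,
        differentiable L xbar /\ grad L xbar = 0 &
        [/\ ex_dd2 f xbar d,
            forall i, i \in active g xbar -> mu i != 0 -> ex_dd2 (g i) xbar d,
            ex_dd2 L xbar d,
            dd2 L xbar d = lambda1 * dd2 f xbar d
              + \sum_(i < m | i \in active g xbar) mu i * dd2 (g i) xbar d &
            0 <= dd2 L xbar d]].
Proof.
have [[Xx gx] xmin] := xbar_min; have [fd_le0 gd_le0] := d_crit.
have df : differentiable f xbar by have [] := f_C1 _ Xx.
have dg i : i \in active g xbar -> differentiable (g i) xbar.
  by move=> /g_C1/(_ _ Xx)[].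
have df_ge0 u : linearizing_cone g xbar u -> 0 <= 'd f xbar u.
  by rewrite Guignard; exact: pseudotangent_cone_diff_ge0.
have fd0 : 'd f xbar d = 0.
  by apply/eqP; rewrite eq_le fd_le0 df_ge0.
have fdd2 := f_dd2 fd0.
have second z : setB2 g xbar d z -> 0 <= 'd f xbar z + dd2 f xbar d.
  pose H : set 'rV[R]_s := [set y | - dd2 f xbar d <= 'd f xbar y].
  have Hclosed : closed H by exact: closed_diff_ge.
  rewrite -CQ2 -lerBlDr sub0r; suff : closure (setA2 X g xbar d) `<=` H by apply.
  have -> : H = closure H by exact: (closure_id _).1.
  apply: closureS => y Ay; rewrite /H /= -subr_ge0 opprK.
  apply: (setA2_second_order X_open f_C1 Xx xmin fd0 fdd2).
  exact: (feasible_parabola X_open xbar_min.1).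
pose V : lmodType R := ('rV[R]_s * R^o)%type.
have scal_snd k (p q : V) : (k *: p + q).2 = k * p.2 + q.2 :> R by [].
(* Homogenization of ['d h xbar z + dd2 h xbar d] at [p = (z, tau)]. *)
pose phi h (p : V) : R := 'd h xbar p.1 + p.2 * dd2 h xbar d.
have phi_lin h : scalar (phi h).
  by move=> k p q; rewrite /phi scal_snd linearD diff_scale; ring.
(* Index [ord0] encodes [tau >= 0]; constraints outside K(xbar,d) become the
   zero functional. *)
pose a (i : 'I_m.+1) (p : V) : R := if unlift ord0 i is Some j then
  if j \in active_crit g xbar d then phi (g j) p else 0 else - p.2.
have [i|||lam [lam0 lamE]] := @farkas R V m.+1 a (fun p => - phi f p).
- rewrite /a => k p q; case: (unlift ord0 i) => [j|] /=; last first.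
    by move: (scal_snd k p q) => /= ->; ring.
  by case: ifP => _; [exact: phi_lin|rewrite mulr0 addr0].
- by move=> k p q; rewrite phi_lin; ring.
- move=> [z tau] az; rewrite oppr_le0 /phi /=.
  have tau0 : 0 <= tau by move: (az ord0); rewrite /a unlift_none oppr_le0.
  have az_crit i : i \in active_crit g xbar d ->
      'd (g i) xbar z + tau * dd2 (g i) xbar d <= 0.
    by move=> iK; move: (az (lift ord0 i)); rewrite /a liftK iK.
  move: tau0; rewrite le_eqVlt => /predU1P[tauE|tau_gt0].
    rewrite -tauE mul0r addr0.
    (* The sum of all [q i] is a large enough coefficient of [d]: all terms are nonnegative, so it
       dominates each [q i] with ['d (g i) xbar d < 0]. Where this derivative is 0, division by zero
       gives [q i = 0], and [az_crit] bounds ['d (g i) xbar z] directly. *)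
    pose q i := `|'d (g i) xbar z| / `|'d (g i) xbar d|.
    have q_ge0 i : 0 <= q i by exact: divr_ge0.
    have : 0 <= 'd f xbar (z + (\sum_i q i) *: d).
      apply: df_ge0 => i gi; rewrite linearD diff_scale.
      have [gid|gid] := eqVneq ('d (g i) xbar d) 0.
        rewrite gid mulr0 addr0; have := az_crit i.
        by rewrite inE gi gid eqxx -tauE mul0r addr0; apply.
      have gid_lt0 : 'd (g i) xbar d < 0 by rewrite lt_neqAle gid gd_le0.
      have qi : q i <= \sum_j q j.
        by rewrite (bigD1 i) //= lerDl sumr_ge0.
      have qE : q i * 'd (g i) xbar d = - `|'d (g i) xbar z|.
        by rewrite /q (ltr0_norm gid_lt0) invrN mulrN mulNr divfK.
      apply: le_trans (lerD (ler_norm _) (ler_wnM2r (ltW gid_lt0) qi)) _.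
      by rewrite qE subrr.
    by rewrite linearD diff_scale fd0 mulr0 addr0.
  have : 0 <= 'd f xbar (tau^-1 *: z) + dd2 f xbar d.
    apply: second => i /az_crit iz.
    by rewrite diff_scale -(ler_pM2l tau_gt0 _ 0) mulr0 mulrDr mulVKf ?gt_eqF.
  by rewrite diff_scale -(pmulr_rge0 _ tau_gt0) mulrDr mulVKf ?gt_eqF.
(* Outside K(xbar,d) Farkas' multiplier belongs to the zero functional and carries no information;
   resetting it to 0 gives complementary slackness. *)
pose mu j := if j \in active_crit g xbar d then lam (lift ord0 j) else 0.
have phiE p : phi f p + \sum_(j < m) mu j * phi (g j) p = lam ord0 * p.2.
  have := lamE p; rewrite big_ord_recl {1}/a unlift_none.
  under eq_bigr => j _.
    have -> : lam (lift ord0 j) * a (lift ord0 j) p = mu j * phi (g j) p.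
      by rewrite /a /mu liftK; case: ifP => // _; rewrite mulr0 mul0r.
    over.
  lra.
(* The identity [phiE] at [(z, 0)] is stationarity; at [(0, 1)] it is the second-order inequality,
   with slack [lam ord0]. *)
have phi_first h z : phi h (z, 0) = 'd h xbar z.
  by rewrite /phi mul0r addr0.
have phi_second h : phi h (0, 1) = dd2 h xbar d.
  by rewrite /phi linear0 add0r mul1r.
have stationary z : 'd f xbar z + \sum_(j < m) mu j * 'd (g j) xbar z = 0.
  have := phiE (z, 0); rewrite phi_first (mulr0 (lam ord0)) => phi0.
  rewrite -[RHS]phi0.
  by congr (_ + _); apply: eq_bigr => j _; rewrite phi_first.
have second_ge0 : 0 <= dd2 f xbar d + \sum_(j < m) mu j * dd2 (g j) xbar d.
  have := phiE (0, 1); rewrite phi_second (mulr1 (lam ord0)) => phi1.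
  rewrite (le_trans (lam0 ord0)) // -phi1 lerD2l; apply: ler_sum => j _.
  by rewrite phi_second.
have mu_crit i : mu i != 0 -> i \in active_crit g xbar d.
  by rewrite /mu; case: ifP => //; rewrite eqxx.
have mu_act i : mu i != 0 -> i \in active g xbar.
  by move=> /mu_crit; rewrite inE => /andP[].
have dL_mu i : mu i != 0 -> differentiable (g i) xbar.
  by move=> /mu_act; exact: dg.
have gdd2 i : mu i != 0 -> ex_dd2 (g i) xbar d.
  by move=> /mu_crit; rewrite inE => /andP[gi /eqP]; exact: g_dd2.
exists 1, mu => L.
have Lcvg := @cvg_dd2_lagrangian _ _ _ _ _ 1 _ _ df dL_mu d fdd2 gdd2.
have Ldd2 : dd2 L xbar d = 1 * dd2 f xbar d + \sum_(i < m) mu i * dd2 (g i) xbar d.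
  by apply: cvg_lim Lcvg; exact: Rhausdorff.
have Ldiff := @is_diff_lagrangian _ _ _ _ _ 1 _ _ df dL_mu.
split; [exact: ltr01| | | |split; [exact: fdd2| | | |]].
- by move=> i; rewrite /mu; case: ifP.
- move=> i; have [->|/mu_act/eqP ->] := eqVneq (mu i) 0; first exact: mul0r.
  exact: mulr0.
- split; first exact: ex_diff.
  apply/rowP => j; rewrite !mxE (diff_lagrangian _ df dL_mu) mul1r.
  exact: stationary.
- by move=> i _; exact: gdd2.
- exact: cvgP Lcvg.
(* Inactive indices have zero multiplier, so both sums agree. *)
- rewrite Ldd2; congr +%R; rewrite [RHS]big_mkcond.
  apply: eq_bigr => i _; case: ifPn => // gi.
  have [->|/mu_act] := eqVneq (mu i) 0; first by rewrite mul0r.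
  by rewrite (negbTE gi).
- by rewrite Ldd2 mul1r; exact: second_ge0.
Qed.
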